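(* Let $\mathcal{F}$ be a Fraïssé class in a countable signature whose Fraïssé limit $U$ is finite. Assume $A$ is a substructure of $U$ such that there exists $h\in\operatorname{Aut}(U)$ with $h\neq\mathrm{id}_U$ and $h\restriction A=\mathrm{id}_A$. Then $\mathcal{F}$ admits no Katětov functor.
   Context: A structure is a model of a first-order language, possibly with algebraic operations. An embedding is a one-to-one mapping that is an isomorphism onto its image. A substructure of $M$ is a subset closed under all operations of $M$ (in particular containing all constants), with induced relations. The age of a structure $M$ is the class of all finitely generated structures embeddable into $M$. A Fraïssé class is a class of finitely generated structures, closed under isomorphism, with countably many isomorphism types, that is hereditary (closed under finitely generated substructures) and has the joint embedding and amalgamation properties (for embeddings); its Fraïssé limit is the unique (up to isomorphism) countable homogeneous structure whose age is the class. A structure is homogeneous if every isomorphism between its finitely generated substructures extends to an automorphism of it. For a Fraïssé class $\mathcal{F}$, let ${}^{\mathrm{emb}}\mathcal{F}$ be the category whose objects are structures from $\mathcal{F}$ and whose arrows are all embeddings between them. Let $\sigma\mathcal{F}$ be the class of all countable (possibly finite) structures whose age is contained in $\mathcal{F}$, and ${}^{\mathrm{emb}}\sigma\mathcal{F}$ the category of all embeddings between structures from $\sigma\mathcal{F}$. A Katětov functor on $\mathcal{F}$ is a functor $K\colon {}^{\mathrm{emb}}\mathcal{F}\to{}^{\mathrm{emb}}\sigma\mathcal{F}$ for which there exists a natural transformation $\eta$ from the identity (the inclusion functor of ${}^{\mathrm{emb}}\mathcal{F}$ into ${}^{\mathrm{emb}}\sigma\mathcal{F}$) to $K$ (so each $\eta_X\colon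 X\to K(X)$ is an embedding) such that for every $X\in\mathcal{F}$ and every one-point extension $e\colon X\to X'$ there exists an embedding $f\colon X'\to K(X)$ satisfying $\eta_X=f\circ e$. Here a one-point extension of $X$ is an embedding $e\colon X\to X'$ with $X'\in\mathcal{F}$ such that $X'$ is generated by $e[X]\cup\{x\}$ for some $x\in X'$. *)

(* Defs.v *)
From mathcomp Require Import all_boot.
From mathcomp Require Import boolp classical_sets functions cardinality.

Set Implicit Arguments.
Unset Strict Implicit.
Unset Printing Implicit Defensive.

Local Open Scope classical_set_scope.

Record signature := Signature {
  fsym : Type;
  rsym : Type;
  far : fsym -> nat; (* symbols of arity 0 are the constants *)
  rar : rsym -> nat }.

Definition countable_signature (L : signature) : Prop :=
  countable [set: fsym L] /\ countable [set: rsym L].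

(* The carrier may be empty (possible only if there are no constants). *)
Record structure (L : signature) := Structure {
  carrier :> Type;
  fn : forall f : fsym L, (far f).-tuple carrier -> carrier;
  rel_of : forall r : rsym L, (rar r).-tuple carrier -> Prop }.
Arguments fn {L} s f _.
Arguments rel_of {L} s r _.

Section Structures.
Variable L : signature.
Implicit Types X Y Z M : structure L.

Definition is_embedding X Y (f : X -> Y) : Prop :=
  [/\ injective f,
      (forall (s : fsym L) (t : (far s).-tuple X),
         f (fn X s t) = fn Y s (map_tuple f t)) &
      (forall (r : rsym L) (t : (rar r).-tuple X),
         rel_of X r t <-> rel_of Y r (map_tuple f t))].

Record embedding X Y := Embedding {
  emb_fun :> X -> Y;
  embP : is_embedding emb_fun }.

Lemma embedding_eq X Y (f g : embedding X Y) : f =1 g -> f = g.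
Proof.
case: f => f fP; case: g => g gP /= /funext fg.
by subst g; rewrite (Prop_irrelevance fP gP).
Qed.

Lemma id_embedding X : is_embedding (@id X).
Proof.
split=> [x y //|s t|r t].
- by congr (fn X s _); apply: val_inj; rewrite /= map_id.
- suff -> : map_tuple id t = t by [].
  by apply: val_inj; rewrite /= map_id.
Qed.

Lemma comp_embedding X Y Z (g : embedding Y Z) (f : embedding X Y) :
  is_embedding (g \o f).
Proof.
case: f => f [fi ff fr]; case: g => g [gi gf gr]; split=> /= [|s t|r t].
- exact: inj_comp.
- by rewrite ff gf; congr (fn Z s _); apply: val_inj; rewrite /= -map_comp.
- rewrite fr gr.
  suff -> : map_tuple g (map_tuple f t) = map_tuple (g \o f) t by [].
  by apply: val_inj; rewrite /= -map_comp.
Qed.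

Definition emb_id X : embedding X X := Embedding (@id_embedding X).
Definition emb_comp X Y Z (g : embedding Y Z) (f : embedding X Y) :
  embedding X Z := Embedding (comp_embedding g f).

Lemma emb_comp1f X Y (f : embedding X Y) : emb_comp (emb_id Y) f = f.
Proof. exact: embedding_eq. Qed.

Lemma emb_compf1 X Y (f : embedding X Y) : emb_comp f (emb_id X) = f.
Proof. exact: embedding_eq. Qed.

Lemma emb_compA X Y Z W (h : embedding Z W) (g : embedding Y Z)
    (f : embedding X Y) :
  emb_comp h (emb_comp g f) = emb_comp (emb_comp h g) f.
Proof. exact: embedding_eq. Qed.

(* Embeddings preserve and reflect the relations, so the bijective ones are
   exactly the isomorphisms. *)
Definition isomorphism X Y (f : embedding X Y) : Prop := bijective f.
Definition automorphism X (h : embedding X X) : Prop := isomorphism h.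
Definition isomorphic X Y : Prop := exists f : embedding X Y, isomorphism f.

Definition op_closed X (A : set X) : Prop :=
  forall (s : fsym L) (t : (far s).-tuple X),
    (forall i, A (tnth t i)) -> A (fn X s t).

Lemma substructure_fn_subproof X (A : set X) (cA : op_closed A)
    (s : fsym L) (t : (far s).-tuple A) :
  fn X s (map_tuple (fun a : A => val a) t) \in A.
Proof. by apply/mem_set/cA => i; rewrite tnth_map; exact: set_valP. Qed.

Definition substructure X (A : set X) (cA : op_closed A) : structure L :=
  @Structure L A
    (fun s t => exist _ (fn X s (map_tuple (fun a : A => val a) t))
                        (substructure_fn_subproof cA t))
    (fun r t => rel_of X r (map_tuple (fun a : A => val a) t)).

Definition generated X (G : set X) : set X := smallest (@op_closed X) G.

Definition finitely_generated X : Prop :=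
  exists2 G : set X, finite_set G & generated G = setT.

Definition age M (X : structure L) : Prop :=
  finitely_generated X /\ inhabited (embedding X M).

Definition homogeneous M : Prop :=
  forall (A B : set M) (cA : op_closed A) (cB : op_closed B)
         (phi : embedding (substructure cA) (substructure cB)),
    finitely_generated (substructure cA) ->
    finitely_generated (substructure cB) ->
    isomorphism phi ->
    exists2 h : embedding M M, automorphism h &
      forall a : A, h (val a) = val (phi a : B).

Record fraisse_class (F : structure L -> Prop) : Prop := FraisseClass {
  fraisse_fg : forall X, F X -> finitely_generated X;
  fraisse_iso : forall X Y, isomorphic X Y -> F X -> F Y;
  fraisse_countable : exists c : nat -> structure L,
    forall X, F X -> exists n, isomorphic (c n) X;
  fraisse_hereditary : forall X (A : set X) (cA : op_closed A),
    F X -> finitely_generated (substructure cA) -> F (substructure cA);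
  fraisse_joint_embedding : forall X Y, F X -> F Y ->
    exists2 Z, F Z & inhabited (embedding X Z) /\ inhabited (embedding Y Z);
  fraisse_amalgamation : forall Z X Y (f : embedding Z X) (g : embedding Z Y),
    F Z -> F X -> F Y ->
    exists2 W, F W & exists (f' : embedding X W) (g' : embedding Y W),
      emb_comp f' f = emb_comp g' g }.

Definition fraisse_limit (F : structure L -> Prop) (U : structure L) : Prop :=
  [/\ countable [set: U], homogeneous U & forall X, age U X <-> F X].

Definition sigma (F : structure L -> Prop) (X : structure L) : Prop :=
  countable [set: X] /\ forall Y, age X Y -> F Y.

End Structures.

Record category := Category {
  obj :> Type;
  hom : obj -> obj -> Type;
  cid : forall a, hom a a;
  ccomp : forall a b c, hom b c -> hom a b -> hom a c;
  ccomp1f : forall a b (f : hom a b), ccomp (cid b) f = f;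
  ccompf1 : forall a b (f : hom a b), ccomp f (cid a) = f;
  ccompA : forall a b c d (h : hom c d) (g : hom b c) (f : hom a b),
    ccomp h (ccomp g f) = ccomp (ccomp h g) f }.
Arguments hom {_} _ _.
Arguments cid {_} a.
Arguments ccomp {_ a b c} _ _.

Record functor (C D : category) := Functor {
  fobj :> C -> D;
  fmap : forall a b : C, hom a b -> hom (fobj a) (fobj b);
  fmap_id : forall a, fmap (cid a) = cid (fobj a);
  fmap_comp : forall a b c (g : hom b c) (f : hom a b),
    fmap (ccomp g f) = ccomp (fmap g) (fmap f) }.
Arguments fmap {C D} _ {a b} _.

Lemma functor_comp_id_subproof (C D E : category) (G : functor D E)
    (K : functor C D) a : fmap G (fmap K (cid a)) = cid (G (K a)).
Proof. by rewrite !fmap_id. Qed.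

Lemma functor_comp_comp_subproof (C D E : category) (G : functor D E)
    (K : functor C D) a b c (g : hom b c) (f : hom a b) :
  fmap G (fmap K (ccomp g f)) = ccomp (fmap G (fmap K g)) (fmap G (fmap K f)).
Proof. by rewrite !fmap_comp. Qed.

Definition functor_comp (C D E : category) (G : functor D E)
    (K : functor C D) : functor C E :=
  @Functor C E (fun a => G (K a)) (fun a b f => fmap G (fmap K f))
    (functor_comp_id_subproof G K) (functor_comp_comp_subproof G K).

Record nat_trans (C D : category) (G H : functor C D) := NatTrans {
  component :> forall a : C, hom (G a) (H a);
  naturality : forall (a b : C) (f : hom a b),
    ccomp (component b) (fmap G f) = ccomp (fmap H f) (component a) }.

Definition full_subcategory (C : category) (P : C -> Prop) : category :=
  @Category {a : C | P a} (fun a b => hom (sval a) (sval b))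
    (fun a => cid (sval a)) (fun a b c g f => ccomp g f)
    (fun a b f => ccomp1f f) (fun a b f => ccompf1 f)
    (fun a b c d h g f => ccompA h g f).

Definition inclusion (C : category) (P : C -> Prop) :
    functor (full_subcategory P) C :=
  @Functor (full_subcategory P) C (fun a => sval a) (fun a b f => f)
    (fun a => erefl) (fun a b c g f => erefl).

Section Katetov.
Variable L : signature.

Definition emb_structures : category :=
  @Category (structure L) (@embedding L) (@emb_id L) (@emb_comp L)
    (@emb_comp1f L) (@emb_compf1 L) (@emb_compA L).

Definition emb_cat (F : structure L -> Prop) : category :=
  @full_subcategory emb_structures F.

Definition one_point_extension (X Y : structure L) (e : embedding X Y) : Prop :=
  exists y : Y, generated (range e `|` [set y]) = setT.

(* [emb_cat F] and [emb_cat (sigma F)] are full subcategories of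
   [emb_structures], so a natural transformation from the inclusion of
   [emb_cat F] into [emb_cat (sigma F)] to [K] is the same thing as one between
   their composites into [emb_structures]; stated this way, it needs no proof
   that [F] is contained in [sigma F]. *)
Definition katetov_functor (F : structure L -> Prop)
    (K : functor (emb_cat F) (emb_cat (sigma F))) : Prop :=
  exists eta : nat_trans (@inclusion emb_structures F)
                 (functor_comp (@inclusion emb_structures (sigma F)) K),
  forall (X X' : emb_cat F) (e : embedding (sval X) (sval X')),
    one_point_extension e ->
    exists f : embedding (sval X') (sval (K X)), eta X = emb_comp f e.

End Katetov.

(* Main.v *)
Require Import Defs.
From mathcomp Require Import all_boot.
From mathcomp Require Import boolp classical_sets functions cardinality.

Set Implicit Arguments.
Unset Strict Implicit.
Unset Printing Implicit Defensive.

Local Open Scope classical_set_scope.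

(** An injective endomap of the finite [U] is onto, and every finitely generated
    substructure of [K U] embeds into [U], so [eta U] is onto.  Let [B] be the
    substructure of all fixed points of [h], with inclusion [i : B -> U].  Since
    [h i = i], also [K h] fixes the range of [K i]; by naturality that range
    corresponds under [eta U] to fixed points of [h], so [eta B] is onto.  But
    then [B] has no proper one-point extension, hence [B = U] and [h = id]. *)

(** If [y] were not a value of [f], its iterates under [f] would be pairwise distinct: cancelling
    [f] from an equality between two of them ends with [y] itself in the range. They would then
    inject [nat] into the finite type. *)
Lemma finite_inj_surj (T : Type) (f : T -> T) :
  finite_set [set: T] -> injective f -> forall y, exists x, f x = y.
Proof.
move=> finT injf y; apply: contrapT => nfy.
have fxy x : f x <> y by move=> fx; apply: nfy; exists x.
apply: infinite_nat.
rewrite -(preimage_setT (fun n => iter n f y)); apply: finite_preimage finT.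
move=> m n _ _; elim: m n => [|m IHm] [|n] //=.
- by move=> /esym/fxy.
- by move=> /fxy.
- by move=> /injf/IHm ->.
Qed.

Section Substructures.
Variable L : signature.
Implicit Types X Y : structure L.

Lemma op_closed_generated X (G : set X) : op_closed (generated G).
Proof.
move=> s t Gt B [cB GB]; apply: (cB) => i.
exact: (Gt i B (conj cB GB)).
Qed.

Definition gen_sub X (G : set X) : structure L :=
  substructure (@op_closed_generated X G).

Lemma is_embedding_val X (A : set X) (cA : op_closed A) :
  @is_embedding L (substructure cA) X (fun a : A => val a).
Proof. by split=> // x y; exact: val_inj. Qed.

Definition sub_incl X (A : set X) (cA : op_closed A) :
  embedding (substructure cA) X := Embedding (is_embedding_val cA).

Lemma embedding_corestrict X Y (f : embedding X Y) (B : set Y)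
    (cB : op_closed B) (fB : forall x, B (f x)) :
  exists g : embedding X (substructure cB), forall x, sub_incl cB (g x) = f x.
Proof.
pose g x : B := exist _ (f x) (mem_set (fB x)).
have gP : @is_embedding L X (substructure cB) g.
  have valg n (t : n.-tuple X) :
      map_tuple (fun b : B => val b) (map_tuple g t) = map_tuple f t.
    by apply: val_inj; rewrite /= -map_comp.
  case: (embP f) => injf fnf relf; split=> [x y /(congr1 val)/injf //|s t|r t].
  - by apply: val_inj; rewrite /= valg fnf.
  - by rewrite relf /= valg.
by exists (Embedding gP).
Qed.

(** Here the closure is taken inside [gen_sub G] and not in [X]. Its image in [X] contains [G] and
    is closed under the operations, so it exhausts [generated G]; injectivity of the inclusion pulls
    this back. *)
Lemma generated_gen_sub X (G : set X) :
  @generated L (gen_sub G) [set x | G (sub_incl _ x)] = setT.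
Proof.
set cG := @op_closed_generated X G; set B := generated _.
apply/seteqP; split=> // x _.
have : generated G `<=` range (sub_incl cG) `&` (sub_incl cG @` B).
  apply: smallest_sub => [s t tB|y Gy].
    (* The entries of [t] are lifted to [gen_sub G], so that the operation can be applied there and
       its value included back into [X]. *)
    have /choice [u uP] i : exists z, B z /\ sub_incl cG z = tnth t i.
      by case: (tB i) => _ [z Bz zt]; exists z.
    have <- : sub_incl cG (fn (gen_sub G) s [tuple u i | i < far s])
              = fn X s t.
      case: (embP (sub_incl cG)) => _ -> _; congr (fn X s _).
      by apply: eq_from_tnth => i; rewrite tnth_map tnth_mktuple (uP i).2.
    split; first by exists (fn (gen_sub G) s [tuple u i | i < far s]).
    exists (fn (gen_sub G) s [tuple u i | i < far s]) => //.
    apply: op_closed_generated => i.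
    by rewrite tnth_mktuple; exact: (uP i).1.
  have gy : generated G y by exact: sub_gen_smallest.
  have [z zy] : exists z, sub_incl cG z = y.
    by exists (exist _ y (mem_set gy)).
  split; first by exists z.
  by exists z => //; apply: sub_gen_smallest; rewrite /mkset zy.
move=> /(_ _ (set_valP x)) [_ [z Bz /val_inj zx]].
by rewrite -zx.
Qed.

Lemma finitely_generated_gen_sub X (G : set X) :
  finite_set G -> finitely_generated (gen_sub G).
Proof.
move=> finG; exists [set x | G (sub_incl (@op_closed_generated X G) x)].
  apply: finite_preimage finG => x y _ _.
  by case: (embP (sub_incl (@op_closed_generated X G))) => + _ _; apply.
exact: generated_gen_sub.
Qed.

Lemma finite_finitely_generated X :
  finite_set [set: X] -> finitely_generated X.
Proof.
move=> finX; exists setT => //; apply/seteqP; split=> // x _.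
exact: sub_gen_smallest.
Qed.

Lemma finite_substructure X (A : set X) (cA : op_closed A) :
  finite_set [set: X] -> finite_set [set: substructure cA].
Proof.
move=> finX; rewrite -(preimage_setT (sub_incl cA)).
by apply: finite_preimage finX => x y _ _; exact: val_inj.
Qed.

Definition fixed_points X (h : embedding X X) : set X := [set x | h x = x].

Lemma op_closed_fixed_points X (h : embedding X X) :
  op_closed (fixed_points h).
Proof.
move=> s t ht; rewrite /fixed_points /=; case: (embP h) => _ -> _.
by congr (fn X s _); apply: eq_from_tnth => i; rewrite tnth_map; exact: ht.
Qed.

(** As [Y] may fail to be finitely generated, only the part generated by the range of [f] and [y] is
    sent back into [X], by some [j]. The composite of [j] with [f] is an injective endomap of [X],
    hence hits the image of [y] under [j]. *)
Lemma embedding_finite_limit_surj (F : structure L -> Prop) X Y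
    (f : embedding X Y) :
  finite_set [set: X] -> (forall Z, age X Z <-> F Z) ->
  (forall Z, age Y Z -> F Z) -> forall y, exists x, f x = y.
Proof.
move=> finX ageX ageY y.
pose G := range f `|` [set y].
pose cG := op_closed_generated (G := G).
have finG : finite_set G.
  by rewrite finite_setU; split; [exact: finite_image|exact: finite_set1].
have /ageX [_ [j]] : F (gen_sub G).
  by apply: ageY; split; [exact: finitely_generated_gen_sub|
                          exists; exact: sub_incl].
have fG x : generated G (f x) by apply: sub_gen_smallest; left; exists x.
have [g gf] := embedding_corestrict cG fG.
have yG : generated G y by apply: sub_gen_smallest; right.
pose z : gen_sub G := exist _ y (mem_set yG).
have [injj _ _] := embP j.
have [injjg _ _] := embP (emb_comp j g).
have [x /= /injj gx] := finite_inj_surj finX injjg (j z).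
by exists x; rewrite -gf gx.
Qed.

End Substructures.

Theorem proposition1p2 (L : signature) (countL : countable_signature L)
    (F : structure L -> Prop) (fraisseF : fraisse_class F)
    (U : structure L) (limitU : fraisse_limit F U)
    (finU : finite_set [set: U])
    (A : set U) (subA : op_closed A)
    (fixA : exists h : embedding U U,
       [/\ automorphism h, h <> emb_id U & {in A, h =1 id}]) :
  ~ exists K : functor (emb_cat F) (emb_cat (sigma F)), katetov_functor K.
Proof.
case: fixA => h [_ hid _] [K [eta etaP]].
case: limitU => _ _ ageU.
(* With every fixed point of [h] included, a point [u] lies in [B] as soon as [h u = u], which is
   the equation that naturality yields. *)
pose cB := op_closed_fixed_points (h := h); pose B := substructure cB.
pose i : embedding B U := sub_incl cB.
have FU : F U.
  by apply/ageU; split; [exact: finite_finitely_generated|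
                         exists; exact: emb_id].
have finB : finite_set [set: B] by exact: finite_substructure.
have FB : F B.
  by apply/ageU; split; [exact: finite_finitely_generated|exists; exact: i].
pose oU : emb_cat F := exist _ U FU.
pose oB : emb_cat F := exist _ B FB.
pose KU := sval (K oU); pose KB := sval (K oB).
pose etaU : embedding U KU := eta oU.
pose etaB : embedding B KB := eta oB.
pose Ki : embedding KB KU := @fmap _ _ K oB oU i.
pose Kh : embedding KU KU := @fmap _ _ K oU oU h.
have hi : emb_comp h i = i by apply: embedding_eq => b; exact: (set_valP b).
have KhKi : emb_comp Kh Ki = Ki.
  by have := @fmap_comp _ _ K oB oU oU h i; rewrite /= hi => <-.
have nat_i b : etaU (i b) = Ki (etaB b).
  exact: (congr1 (fun f : embedding B KU => f b) (@naturality _ _ _ _ eta oB oU i)).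
have nat_h u : etaU (h u) = Kh (etaU u).
  exact: (congr1 (fun f : embedding U KU => f u) (@naturality _ _ _ _ eta oU oU h)).
have etaU_surj : forall y, exists u, etaU u = y.
  have [_ ageKU] : sigma F KU := svalP (K oU).
  exact: embedding_finite_limit_surj etaU finU ageU ageKU.
have [injU _ _] := embP etaU; have [injKi _ _] := embP Ki.
have etaB_surj y : exists b, etaB b = y.
  (* Since [Kh] fixes [Ki y = etaU u], naturality gives [etaU (h u) = etaU u], so [u] is the point
     of [B] to be sent to [y]. *)
  have [u uy] := etaU_surj (Ki y).
  have hu : fixed_points h u.
    apply: injU; rewrite nat_h uy.
    exact: (congr1 (fun f : embedding KB KU => f y) KhKi).
  exists (exist _ u (mem_set hu) : B); apply: injKi.
  by rewrite -nat_i -uy.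
apply: hid; apply: embedding_eq => u /=.
(* Adjoining an arbitrary [u] to [B] gives a one-point extension [e]; [u] is fixed by [h] once [e]
   is shown to reach it. *)
pose G := range i `|` [set u]; pose cG := op_closed_generated (G := G).
have finG : finite_set G.
  by rewrite finite_setU; split; [exact: finite_image|exact: finite_set1].
have FG : F (gen_sub G).
  by apply/ageU; split; [exact: finitely_generated_gen_sub|
                         exists; exact: sub_incl].
have iG b : generated G (i b) by apply: sub_gen_smallest; left; exists b.
have [e ei] := embedding_corestrict cG iG.
have uG : generated G u by apply: sub_gen_smallest; right.
pose v : gen_sub G := exist _ u (mem_set uG).
have one_pt : one_point_extension e.
  exists v; rewrite -(generated_gen_sub G); congr generated.
  (* The generators [G], seen inside [gen_sub G], are exactly the range of [e] and [v]. *)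
  apply/seteqP; split=> x /=.
    by case=> [[b _ <-]|->]; [left; exists b => //; exact: (esym (ei b))|right].
  case=> [[b _ bx]|xu]; last by right; apply: val_inj.
  by left; exists b => //; apply: val_inj; rewrite -[RHS]bx -ei.
have [f fP] := etaP oB (exist _ (gen_sub G) FG) e one_pt.
have [injf _ _] := embP f.
(* Surjectivity of [etaB], which is [f] after [e], turns [f v] into [f (e b)], and [f] cancels. *)
have [b bv] := etaB_surj (f v).
have ev : e b = v.
  by apply: injf; rewrite -bv /etaB fP.
have <- : i b = u by rewrite -ei ev.
exact: (set_valP b).
Qed.
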